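(* There exist absolute constants $\beta\ge 1$ and $c>0$ such that every weighted graph $G=(V,E,w)$ with treewidth $\mathrm{tw}$ admits a $(\beta,s)$-sparse cover scheme with $s=O(\mathrm{tw}^{c})$ (i.e. $s=\mathrm{poly}(\mathrm{tw})$), where the diameter guarantee is with respect to strong diameter. That is, for every $\Delta>0$ there is a collection $\mathcal{C}$ of subsets of $V$ such that (i) for every $C\in\mathcal{C}$, $\max_{u,v\in C} d_{G[C]}(u,v)\le \Delta$; (ii) for every $v\in V$ there is $C\in\mathcal{C}$ with $B_G(v,\Delta/\beta)\subseteq C$; (iii) every vertex belongs to at most $s$ sets of $\mathcal{C}$.
   Context: $G=(V,E,w)$ is a connected undirected graph with nonnegative edge weights; $d_G$ is its shortest-path metric, $G[C]$ the subgraph induced by $C$, and $d_{G[C]}$ its shortest-path metric. $B_G(v,r)=\{u\in V:d_G(v,u)\le r\}$. *)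

(* Defs.v *)
From HB Require Import structures.
From mathcomp Require Import all_boot all_order all_algebra.
From mathcomp Require Import all_classical all_reals.
From mathcomp Require Import ereal exp.
From Stdlib Require Import Rdefinitions.
From mathcomp Require Import Rstruct.
Set Implicit Arguments. Unset Strict Implicit. Unset Printing Implicit Defensive.
Import Order.TTheory GRing.Theory Num.Theory.
Local Open Scope ring_scope.

Definition weighted_graph (V : finType) (E : rel V) (w : V -> V -> R) : Prop :=
  [/\ symmetric E, irreflexive E,
      (forall u v, E u v -> 0 <= w u v) &
      (forall u v, E u v -> w u v = w v u)].

Definition connected_graph (V : finType) (E : rel V) : Prop :=
  forall u v, connect E u v.

Definition induced_rel (V : finType) (E : rel V) (C : {set V}) : rel V :=
  [rel x y | [&& E x y, x \in C & y \in C]].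

Definition walk_len (V : finType) (w : V -> V -> R) (u : V) (p : seq V) : R :=
  \sum_(e <- zip (u :: p) p) w e.1 e.2.

(* d_{G[C]}(u,v): infimum of lengths of walks from u to v inside G[C]
   (+oo if there is none, e.g. if u or v is not in C). *)
Definition dist_in (V : finType) (E : rel V) (w : V -> V -> R) (C : {set V})
    (u v : V) : \bar R :=
  ereal_inf [set (walk_len w u p)%:E | p in
    [set p : seq V | [&& u \in C, path (induced_rel E C) u p & last u p == v]]].

Definition dist (V : finType) (E : rel V) (w : V -> V -> R) (u v : V) : \bar R :=
  dist_in E w [set: V]%SET u v.

(* A (finite) tree on index type I, given by a symmetric irreflexive relation t:
   nonempty, connected, with exactly #|I| - 1 (undirected) edges. *)
Definition is_tree (I : finType) (t : rel I) : Prop :=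
  [/\ leq 1 #|I|, symmetric t, irreflexive t,
      (forall i j, connect t i j) &
      #|[set p : I * I | t p.1 p.2]| = muln 2 (subn #|I| 1)].

Definition has_tree_decomposition_of_width (V : finType) (E : rel V) (k : nat) : Prop :=
  exists (I : finType) (t : rel I) (B : I -> {set V}),
    [/\ is_tree t,
        (forall v, exists i, v \in B i),
        (forall u v, E u v -> exists i, (u \in B i) && (v \in B i)),
        (forall v i j, v \in B i -> v \in B j ->
           connect [rel x y | [&& t x y, v \in B x & v \in B y]] i j) &
        (forall i, leq #|B i| k.+1)].

Definition is_treewidth (V : finType) (E : rel V) (tw : nat) : Prop :=
  has_tree_decomposition_of_width E tw /\
  forall k, has_tree_decomposition_of_width E k -> leq tw k.

Definition strong_sparse_cover (V : finType) (E : rel V) (w : V -> V -> R)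
    (beta s Delta : R) (cov : {set {set V}}) : Prop :=
  [/\ (forall C, C \in cov -> forall u v, u \in C -> v \in C ->
          (dist_in E w C u v <= Delta%:E)%E),
      (forall v, exists2 C, C \in cov &
          forall u, (dist E w v u <= (Delta / beta)%:E)%E -> u \in C) &
      (forall v, (#|[set C in cov | v \in C]|%:R <= s))].

(* Main.v *)
Require Import Defs.
From HB Require Import structures.
From mathcomp Require Import all_boot all_order all_algebra.
From mathcomp Require Import all_classical all_reals.
From mathcomp Require Import ereal exp.
From Stdlib Require Import Rdefinitions.
From mathcomp Require Import Rstruct.
From mathcomp Require Import fintype finset zify lra.
Import Order.TTheory GRing.Theory Num.Theory.
Local Open Scope ring_scope.

Set Implicit Arguments.
Unset Strict Implicit.
Unset Printing Implicit Defensive.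

(** Root the tree decomposition; [below p] is the set of vertices whose topmost
node is a descendant of [p], so that [bag p] separates [below p] from the rest.
With r = Delta/16, cut the tree top-down into segments: a node starts a new
segment, and becomes its core, as soon as its bag contains no vertex within
distance 4r of the bag of the current core. An r-ball with its highest vertex in
the segment of the core [p] either meets the 4r-neighbourhood of [bag p], and then
lies in a cluster of radius 8r centred at a vertex of [bag p] and living in
[below p]; or it survives the deletion of this neighbourhood, which removes at
least one vertex from every nonempty bag of the segment, so that these balls are
covered by induction on the bag size.

The multiplicity grows only additively with the bag size. Consecutive cores are
more than 4r apart, so a vertex sees the clusters centred in the bags of at most
two cores. The recursive cluster families of different segments are disjoint: a
path of length at most 8r that leaves a segment and comes back to it stays within
4r of the bag where it left, hence inside the neighbourhood deleted from the
recursive instance of the next segment. Summing 1 + 2l over the bag sizes l gives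
a multiplicity quadratic in the treewidth. *)

(** * Walks of bounded length inside a vertex set *)

Section Reach.
Variables (K : realFieldType) (V : finType) (E : rel V) (w : V -> V -> K).
Hypothesis Esym : symmetric E.
Hypothesis w_ge0 : forall u v, E u v -> 0 <= w u v.
Hypothesis w_sym : forall u v, E u v -> w u v = w v u.
Implicit Types (D : {set V}) (x y z : V) (L M : K).

(** [L] only bounds the length of a walk from above, so walks are cut and joined without any
    infimum. *)
Inductive reach D x : V -> K -> Prop :=
| reach_nil L of x \in D & 0 <= L : reach D x x L
| reach_rcons y z L M of reach D x y L & E y z & z \in D & L + w y z <= M :
    reach D x z M.

Lemma reach_ge0 D x y L : reach D x y L -> 0 <= L.
Proof.
elim=> [//|y' z L' M _ L'_ge0 Eyz _ le_M].
by rewrite (le_trans _ le_M)// addr_ge0 // w_ge0.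
Qed.

Lemma reach_end D x y L : reach D x y L -> y \in D.
Proof. by case. Qed.

Lemma reach_le D x y L M : L <= M -> reach D x y L -> reach D x y M.
Proof.
move=> le_LM r; case: r le_LM => [L' xD L'_ge0|y' z L' M' r Eyz zD le_M'] le_LM.
  by apply: reach_nil => //; exact: le_trans le_LM.
by apply: reach_rcons r Eyz zD _; exact: le_trans le_LM.
Qed.

Lemma reach_sub D D' x y L : D \subset D' -> reach D x y L -> reach D' x y L.
Proof.
move=> /subsetP DD'; elim=> [L' /DD' xD'|y' z L' M _ r Eyz /DD' zD' le_M].
  exact: reach_nil.
exact: reach_rcons r Eyz zD' le_M.
Qed.

Lemma reach_trans D x y z L M :
  reach D x y L -> reach D y z M -> reach D x z (L + M).
Proof.
move=> rxy; elim=> [M' _ M'_ge0|y' z' M' N _ r Eyz zD le_N].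
  by apply: reach_le rxy; rewrite lerDl.
by apply: reach_rcons r Eyz zD _; rewrite -addrA lerD2l.
Qed.

Lemma reach_sym D x y L : reach D x y L -> reach D y x L.
Proof.
elim=> [M xD M_ge0|y' z M N r IH Eyz zD le_N]; first exact: reach_nil.
have ryz : reach D z y' (w y' z).
  apply: (@reach_rcons D z z y' 0); first exact: reach_nil.
  - by rewrite Esym.
  - exact: reach_end r.
  - by rewrite add0r (w_sym Eyz).
by apply: reach_le (reach_trans ryz IH); rewrite addrC.
Qed.

(** Each [z] on the walk splits its extension to [t] into parts of total length at most [L + M].
    Sets defined by such a budget thus contain whole walks, which gives strong diameter bounds. *)
Lemma reach_between D D' x y t L M :
  (forall z N N', reach D x z N -> reach D z t N' -> N + N' <= L + M ->
    z \in D') ->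
  reach D x y L -> reach D y t M -> reach D' x y L.
Proof.
move=> inD' r; elim: r M inD' => [N xD N_ge0|y' z N N' r IH Eyz zD le_N'] M inD' rt.
  apply: reach_nil => //; apply: (inD' _ 0 M _ rt); first exact: reach_nil.
  by rewrite lerD2r.
have rt' : reach D y' t (w y' z + M).
  apply: reach_trans rt; apply: (@reach_rcons D y' y' z 0) => //.
    by apply: reach_nil => //; exact: reach_end r.
  by rewrite add0r.
have rxz : reach D x z N' by exact: reach_rcons r Eyz zD _.
apply: (reach_rcons (IH _ _ rt') Eyz _ le_N'); last exact: (inD' _ _ _ rxz rt).
move=> v n n' rv rv' le_n; apply: (inD' _ _ _ rv rv').
by apply: le_trans le_n _; rewrite addrA lerD2r.
Qed.

End Reach.

(** * Bounded walks and the shortest-path infimum *)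

Section Walks.
Variables (V : finType) (E : rel V) (w : V -> V -> R).
Implicit Types (D : {set V}) (x y z : V) (L M : R).

Lemma walk_len_rcons x p z :
  walk_len w x (rcons p z) = walk_len w x p + w (last x p) z.
Proof.
rewrite /walk_len; elim: p x => [|a p IH] x /=.
  by rewrite big_cons !big_nil addrC.
by rewrite !big_cons IH addrA.
Qed.

Lemma reach_dist D x y L : reach E w D x y L -> (dist_in E w D x y <= L%:E)%E.
Proof.
move=> r.
suff [p [xD pth lst len]] : exists p, [/\ x \in D,
    path (induced_rel E D) x p, last x p = y & walk_len w x p <= L].
  apply: le_trans (_ : (walk_len w x p)%:E <= _)%E; last by rewrite lee_fin.
  apply: ereal_inf_lbound; exists p => //=.
  by apply/and3P; split=> //; apply/eqP.
elim: r => [M xD M_ge0|y' z M N r [p [xD pth lst len]] Eyz zD le_N].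
  by exists [::]; split=> //; rewrite /walk_len big_nil.
exists (rcons p z); rewrite rcons_path last_rcons walk_len_rcons pth lst.
split=> //; first by apply/and4P; split=> //; exact: reach_end r.
by apply: le_trans le_N; rewrite lerD2r.
Qed.

(** The strict slack spares a proof that the infimum is attained. *)
Lemma dist_reach D x y L M :
  L < M -> (dist_in E w D x y <= L%:E)%E -> reach E w D x y M.
Proof.
move=> lt_LM le_L.
have /ereal_inf_lt [_ [p /and3P[xD pth /eqP <-] <-]] :
  (dist_in E w D x y < M%:E)%E by rewrite (le_lt_trans le_L) ?lte_fin.
rewrite lte_fin => /ltW le_M; apply: reach_le le_M _.
elim/last_ind: p pth {le_L lt_LM} => [_|p z IH].
  by apply: reach_nil; rewrite // /walk_len big_nil.
rewrite rcons_path last_rcons walk_len_rcons => /andP[pth /and3P[Epz _ zD]].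
exact: reach_rcons (IH pth) Epz zD _.
Qed.

End Walks.

(** * Rooting the tree of a decomposition *)

Lemma connected_bfs (I : finType) (t : rel I) (root : I) :
  (forall i, connect t root i) ->
  exists (depth : I -> nat) (parent : I -> I),
    parent root = root /\
    forall a, a != root ->
      depth a = (depth (parent a)).+1 /\ t (parent a) a.
Proof.
move=> conn.
pose walk a n := `[< exists p, [/\ path t root p, last root p = a & size p = n] >].
have walk_ex a : exists n, walk a n.
  have /connectP[p pth ->] := conn a; exists (size p); apply/asboolP.
  by exists p.
pose depth a := ex_minn (walk_ex a).
(* The default is taken at [root], whose depth is 0, and makes [root] a fixed point. *)
pose parent a := odflt root [pick b | t b a && (depth a == (depth b).+1)].
have depth_root : depth root = 0%nat.
  rewrite /depth; case: ex_minnP => n _ /(_ 0%nat) min_n; apply/eqP.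
  by rewrite -leqn0 min_n //; apply/asboolP; exists [::].
exists depth, parent; split=> // [|a a_root].
  by rewrite /parent; case: pickP => //= b; rewrite depth_root andbF.
rewrite /parent; case: pickP => [b /andP[tba /eqP ->]//|no_b].
have [p [pth lst sz]] : exists p, [/\ path t root p, last root p = a & size p = depth a].
  by rewrite /depth; case: ex_minnP => n /asboolP.
case/lastP: p pth lst sz => [_ /= eq_a|p b]; first by rewrite -eq_a eqxx in a_root.
rewrite rcons_path last_rcons size_rcons => /andP[pth tpb] eq_b; subst b => sz.
(* The penultimate vertex of a shortest walk to [a] is a valid parent, so the [pick] succeeds. *)
have /negP[] := no_b (last root p); rewrite tpb /= eqn_leq; apply/andP; split.
  rewrite {1}/depth; case: ex_minnP => n _; apply; apply/asboolP.
  have : walk (last root p) (depth (last root p)) by rewrite /depth; case: ex_minnP.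
  move/asboolP=> [q [qth qlst qsz]]; exists (rcons q a).
  by rewrite rcons_path qlst qth last_rcons size_rcons qsz.
rewrite -sz ltnS {1}/depth; case: ex_minnP => n _; apply; apply/asboolP.
by exists p.
Qed.

(* The n - 1 edges (parent a, a) already exhaust the edges of the tree. *)
Lemma tree_parent (I : finType) (t : rel I) : is_tree t ->
  exists (root : I) (depth : I -> nat) (parent : I -> I),
    [/\ parent root = root,
        forall a, a != root -> depth a = (depth (parent a)).+1 &
        forall a b, t a b -> a != root /\ b = parent a \/ b != root /\ a = parent b].
Proof.
case=> I_gt0 t_sym _ t_conn t_card; have /card_gt0P[root _] := I_gt0.
have [depth [parent [parent_root par]]] := connected_bfs (t_conn root).
exists root, depth, parent; split=> // [a /par[]//|a b tab].
pose up := [set (a, parent a) | a in [set~ root]]%SET.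
pose down := [set (parent a, a) | a in [set~ root]]%SET.
have card_up : #|up| = #|I|.-1.
  by rewrite card_in_imset ?cardsC1 // => c d _ _ [].
have card_down : #|down| = #|I|.-1.
  by rewrite card_in_imset ?cardsC1 // => c d _ _ [].
have up_down : [disjoint up & down].
  apply/pred0P => -[c d] /=; apply/negP => /andP[/imsetP[x + [-> ->]]].
  rewrite !inE => /par[x_par _] /imsetP[y + [eq_x eq_y]].
  by rewrite !inE => /par[y_par _]; rewrite -eq_x in y_par; rewrite eq_y in x_par; lia.
have sub : (up :|: down \subset [set p : I * I | t p.1 p.2])%SET.
  rewrite subUset; apply/andP; split; apply/subsetP => _ /imsetP[c + ->].
    by rewrite !inE => /par[_]; rewrite t_sym.
  by rewrite !inE => /par[_].
have /eqP eq_edges : (up :|: down == [set p : I * I | t p.1 p.2])%SET.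
  rewrite eqEcard sub t_card /= cardsU card_up card_down.
  by rewrite (disjoint_setI0 up_down) cards0 subn0 addnn -muln2 mulnC subn1.
have : ((a, b) \in up :|: down)%SET by rewrite eq_edges inE.
rewrite in_setU => /orP[] /imsetP[c + [-> ->]]; rewrite !inE; first by left.
by right.
Qed.

(** Connectedness of the nodes holding [v] becomes [bag_parent]: climbing the tree, [v] stays in the
    bags until [top v]. *)
Record rooted_decomposition (V : finType) (E : rel V) (k : nat) :=
  RootedDecomposition {
  node : finType;
  node_root : node;
  depth : node -> nat;
  parent : node -> node;
  bag : node -> {set V};
  top : V -> node;
  parent_root : parent node_root = node_root;
  depth_parent : forall a, a != node_root -> depth a = (depth (parent a)).+1;
  bag_top : forall v, v \in bag (top v);
  bag_parent : forall v a, v \in bag a -> a != top v ->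
    a != node_root /\ v \in bag (parent a);
  bag_edge : forall u v, E u v -> exists a, (u \in bag a) && (v \in bag a);
  card_bag : forall a, (#|bag a| <= k.+1)%nat }.

(** * The ancestor order of a rooted tree *)

Section Ancestors.
Variables (I : finType) (root : I) (depth : I -> nat) (parent : I -> I).
Hypothesis parent_root : parent root = root.
Hypothesis depth_parent :
  forall a, a != root -> depth a = (depth (parent a)).+1.

Definition anc (p a : I) := fconnect parent a p.

Lemma anc_refl a : anc a a. Proof. exact: connect0. Qed.

Lemma anc_trans b a c : anc a b -> anc b c -> anc a c.
Proof. by move=> ab bc; exact: connect_trans ab. Qed.

Lemma anc_parent a : anc (parent a) a. Proof. exact: fconnect1. Qed.

Lemma anc_root a : anc root a.
Proof.
elim: {a}(depth a) {-2}a (leqnn (depth a)) => [|n IH] a.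
  by have [->|/depth_parent ->//] := eqVneq a root; rewrite anc_refl.
have [->|/depth_parent ->] := eqVneq a root; first by rewrite anc_refl.
by rewrite ltnS => /IH anc_par; exact: anc_trans (anc_parent a).
Qed.

Lemma anc_inv p a : anc p a -> p = a \/ a != root /\ anc p (parent a).
Proof.
move=> /iter_findex; case: findex => [|n]; first by left.
rewrite iterSr => par_p; have [a_root|a_root] := eqVneq a root; last first.
  by right; split=> //; rewrite /anc -par_p fconnect_iter.
left; rewrite -par_p a_root parent_root.
by elim: n {par_p} => //= n ->.
Qed.

Lemma anc_depth p a : anc p a -> p = a \/ (depth p < depth a)%nat.
Proof.
elim: {a}(depth a) {-2}a (leqnn (depth a)) => [|n IH] a le_a /anc_inv[|[a_root]].
- by left.
- by move: le_a; rewrite depth_parent.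
- by left.
move: le_a; rewrite (depth_parent a_root) ltnS => /IH{}IH /IH[->|lt_p]; right.
  by [].
by rewrite ltnW.
Qed.

Lemma anc_antisym a b : anc a b -> anc b a -> a = b.
Proof.
by move=> /anc_depth[//|lt_ab] /anc_depth[//|]; rewrite ltnNge ltnW.
Qed.

Lemma anc_total p q a : anc p a -> anc q a -> anc p q \/ anc q p.
Proof.
move=> /iter_findex <- /iter_findex <-; move: (findex _ _ _) (findex _ _ _) => m n.
have [le_mn|/ltnW le_nm] := leqP m n; [left|right].
  by rewrite -(subnK le_mn) iterD; exact: fconnect_iter.
by rewrite -(subnK le_nm) iterD; exact: fconnect_iter.
Qed.

End Ancestors.

(** If [parent a] does not hold [v], the connected set of nodes holding [v] cannot leave the subtree
    of [a]; minimal depth of [top v] then forces [a = top v]. *)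
Lemma tree_decomposition_rooted (V : finType) (E : rel V) k :
  has_tree_decomposition_of_width E k -> inhabited (rooted_decomposition E k).
Proof.
move=> [I [t [B [tree_t B_ex B_edge B_conn B_card]]]].
have [root [depth [parent [parent_root depth_parent t_parent]]]] :=
  tree_parent tree_t.
pose top v := [arg min_(a < xchoose (B_ex v) | v \in B a) depth a].
have topP v : v \in B (top v) /\ forall a, v \in B a -> (depth (top v) <= depth a)%nat.
  rewrite /top; case: arg_minnP => [|a va min_a]; last by split.
  exact: (xchooseP (B_ex v)).
split; apply: (@RootedDecomposition _ _ _ I root depth parent B top) => //.
  by move=> v; case: (topP v).
move=> v a va a_top; have [v_top min_top] := topP v.
suff a_anc : ~ anc parent a (top v).
  have a_root : a != root.
    by apply/negP => /eqP a_root; apply: a_anc; rewrite a_root; exact: (anc_root depth_parent).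
  split=> //; apply/negPn/negP => v_par; apply: a_anc.
  have /connectP[p pth ->] := B_conn v _ _ va v_top.
  elim/last_ind: p pth => [_|p c IH]; first exact: anc_refl.
  rewrite rcons_path last_rcons => /andP[/IH{}IH /and3P[/t_parent ed _ vc]].
  case: ed IH => -[]; last by move=> _ -> /anc_trans; apply; exact: anc_parent.
  move=> _ eq_c /(anc_inv parent_root) [eq_a|[_]]; last by rewrite eq_c.
  by rewrite eq_c -eq_a (negbTE v_par) in vc.
move=> /(anc_depth parent_root depth_parent)[eq_a|].
  by rewrite eq_a eqxx in a_top.
by rewrite ltnNge min_top.
Qed.

(** * Bags as separators, and segments of the tree *)

Section Decomposition.
Variables (V : finType) (E : rel V) (k : nat) (T : rooted_decomposition E k).
Implicit Types (u v x y z : V) (a c p q : node T) (D H : {set V}).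

Notation "p <: a" := (anc (@parent _ _ _ T) p a) (at level 70).

Definition below p := [set v | p <: top T v]%SET.
(** This is the union of all bags in the subtree of [p]. *)
Definition region p := (below p :|: bag p)%SET.

Lemma bag_anc v a : v \in bag a -> top T v <: a.
Proof.
elim: {a}(depth a) {-2}a (leqnn (depth a)) => [|n IH] a le_a va.
  have [->|a_top] := eqVneq a (top T v); first exact: anc_refl.
  have [a_root _] := bag_parent va a_top.
  by move: le_a; rewrite depth_parent.
have [->|a_top] := eqVneq a (top T v); first exact: anc_refl.
have [a_root va'] := bag_parent va a_top.
move: le_a; rewrite depth_parent // ltnS => /IH/(_ va') /anc_trans; apply.
exact: anc_parent.
Qed.

Lemma bag_convex v a c : v \in bag a -> top T v <: c -> c <: a -> v \in bag c.
Proof.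
move=> va vc; elim: {a}(depth a) {-2}a (leqnn (depth a)) va => [|n IH] a le_a va.
all: move=> /(anc_inv (parent_root T)) [->//|[a_root ca]].
  by move: le_a; rewrite depth_parent.
have [a_top|a_top] := eqVneq a (top T v); last first.
  have [_ va'] := bag_parent va a_top; apply: IH ca => //.
  by move: le_a; rewrite depth_parent.
suff -> : c = a by [].
apply: (anc_antisym (parent_root T) (@depth_parent _ _ _ T)).
  exact: anc_trans ca (anc_parent _ _).
by rewrite a_top.
Qed.

Lemma bag_region p a v : p <: a -> v \in bag a -> v \in region p.
Proof.
move=> pa va; have va' := bag_anc va; rewrite /region !inE.
by have [->//|vp] := anc_total pa va'; rewrite (bag_convex va vp pa) orbT.
Qed.

Lemma top_below v : v \in below (top T v).
Proof. by rewrite inE; exact: anc_refl. Qed.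

Lemma below_sub p q : p <: q -> below q \subset below p.
Proof. by move=> pq; apply/subsetP => v; rewrite !inE; exact: anc_trans. Qed.

(** A bag holding the edge contains [u], hence sits in the subtree of [p]. So [below p] is left only
    through [bag p]. *)
Lemma edge_region p u v : E u v -> u \in below p -> v \in region p.
Proof.
move=> /(bag_edge T)[a /andP[ua va]]; rewrite inE => pu.
by apply: bag_region va; exact: anc_trans (bag_anc ua).
Qed.

Fixpoint core_rec (hit : rel (node T)) (p0 : node T) n a :=
  if n is n'.+1 then
    if a == p0 then a else
    let p := core_rec hit p0 n' (parent a) in if hit p a then p else a
  else a.

(* [core] cuts the subtree under [p0] into segments, the classes of nodes with
   the same core: a node joins the segment of its parent when the core of that
   segment hits it, and starts a new segment otherwise. *)
Lemma exists_core (hit : rel (node T)) p0 :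
    (forall p c a, p <: c -> p != c -> c <: a -> hit p a -> hit p c) ->
  exists core : node T -> node T, forall a, p0 <: a ->
    [/\ p0 <: core a, core a <: a,
        forall c, core a <: c -> c <: a -> core c = core a,
        core a != a -> hit (core a) a &
        core a = a -> forall p, p0 <: p -> core p = p -> p <: a -> p != a ->
          ~~ hit p a].
Proof.
move=> hit_up; pose core a := core_rec hit p0 (depth a) a; exists core.
have antisym := anc_antisym (parent_root T) (@depth_parent _ _ _ T).
have core0 : core p0 = p0 by rewrite /core; case: (depth p0) => //= n; rewrite eqxx.
have coreS a : a != p0 -> a != node_root T -> core a =
    if hit (core (parent a)) a then core (parent a) else a.
  by move=> /negbTE a_p0 a_root; rewrite /core (depth_parent a_root) /= a_p0.
move=> a; elim: {a}(depth a).+1 {-2}a (ltnSn (depth a)) => [//|n IH] a le_a p0a.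
have [eq_a|a_p0] := eqVneq a p0.
  rewrite eq_a core0; split=> //; rewrite ?anc_refl ?eqxx //.
    by move=> c p0c cp0; rewrite (antisym _ _ cp0 p0c).
  by move=> _ p p0p _ pp0; rewrite (antisym _ _ p0p pp0) eqxx.
have [eq_a|[a_root p0b]] := anc_inv (parent_root T) p0a.
  by rewrite eq_a eqxx in a_p0.
set b := parent a in p0b; have ba : b <: a := anc_parent _ _.
have lt_ba : (depth b < depth a)%nat by rewrite (depth_parent a_root).
have [p0cb cbb core_cb hit_cb no_hit_cb] := IH b (leq_trans lt_ba le_a) p0b.
have Nab : ~ a <: b.
  move=> ab; have eq_ab := antisym _ _ ab ba.
  by rewrite -eq_ab ltnn in lt_ba.
rewrite (coreS a a_p0 a_root) -/b; case: ifPn => [hit_a|no_hit]; split=> //.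
- exact: anc_trans ba.
- move=> c cbc /(anc_inv (parent_root T)) [->|[_ cb]]; last exact: core_cb.
  by rewrite coreS // hit_a.
- by move=> eq_cb; rewrite eq_cb in cbb.
- exact: anc_refl.
- by move=> c ac ca; rewrite (antisym _ _ ca ac) coreS // (negbTE no_hit).
- by rewrite eqxx.
move=> _ p p0p core_p /(anc_inv (parent_root T)) [->|[_ pb] p_a].
  by rewrite eqxx.
have [->//|p_cb] := eqVneq p (core b).
have [pcb|cbp] := anc_total pb cbb; last first.
  by rewrite -core_p (core_cb p cbp pb) eqxx in p_cb.
(* An older core [p] hitting [a] would also hit [core b], which lies between them, against the
   induction hypothesis at [core b]. *)
apply/negP => /(hit_up p (core b) a pcb p_cb (anc_trans cbb ba)); apply/negP.
have le_cb : (depth (core b) < n)%nat.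
  have [eq_cb|lt_cb] := anc_depth (parent_root T) (@depth_parent _ _ _ T) cbb.
    by rewrite eq_cb; exact: leq_trans lt_ba le_a.
  exact: leq_trans (ltn_trans lt_cb lt_ba) le_a.
have [_ _ _ _ no_hit_ccb] := IH _ le_cb p0cb.
by apply: no_hit_ccb => //; apply: core_cb => //; exact: anc_refl.
Qed.

End Decomposition.

(** * Cutting walks at bags; metric balls *)

Section Separation.
Variables (K : realFieldType) (V : finType) (E : rel V) (w : V -> V -> K).
Hypothesis Esym : symmetric E.
Hypothesis w_ge0 : forall u v, E u v -> 0 <= w u v.
Hypothesis w_sym : forall u v, E u v -> w u v = w v u.
Variables (k : nat) (T : rooted_decomposition E k).
Implicit Types (u v x y z : V) (a c p q : node T) (D H : {set V}).

Notation "p <: a" := (anc (@parent _ _ _ T) p a) (at level 70).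
Notation reach := (reach E w).

(** Going back from [y], a vertex of [below q] has its predecessor in [region q]; as [x] is outside
    [below q], a vertex of [bag q] is met, and the walk is cut there. *)
Lemma reach_separator D q x y L :
    reach D x y L -> x \notin below q -> y \in region q ->
  exists z M N, [/\ z \in bag q :&: D, reach D x z M,
    reach (D :&: region q) z y N & M + N <= L].
Proof.
move=> + xq; elim=> [M xD M_ge0|y' z M N rxy IH Eyz zD le_N] yq.
all: move: (yq); rewrite /region in_setU => /orP[].
- by rewrite (negbTE xq).
- move=> x_bag; exists x, M, 0; split; rewrite ?addr0 ?inE ?x_bag //.
    exact: reach_nil.
  by apply: reach_nil; rewrite // !inE x_bag orbT xD.
- move=> z_below.
  have y'q : y' \in region q.
    by apply: edge_region z_below; rewrite Esym.
  have [v [M' [N' [v_bag rxv rvy le_M]]]] := IH y'q.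
  exists v, M', (N' + w y' z); split=> //; last first.
    by rewrite addrA (le_trans _ le_N) // lerD2r.
  by apply: (reach_rcons rvy Eyz) => //; rewrite in_setI zD.
move=> z_bag; exists z, N, 0; split; rewrite ?addr0 ?inE ?z_bag //.
  exact: reach_rcons rxy Eyz zD le_N.
apply: reach_nil => //; rewrite !inE z_bag orbT zD //.
Qed.

(** Cut at the last visit to [bag p]: the rest stays in [below p], as in the domain of a cluster
    centred at [z]. *)
Lemma reach_exit H p s y L :
    reach (H :&: region p) s y L -> s \in bag p ->
  exists2 z, z \in bag p :&: H & reach (z |: (H :&: below p)) z y L.
Proof.
elim=> [M sH M_ge0|y' z M N rsy IH Eyz zH le_N] s_bag.
  exists s; first by move: sH; rewrite !inE s_bag => /andP[->].
  by apply: reach_nil => //; exact: setU11.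
have [z_bag|z_bag] := boolP (z \in bag p).
  exists z; first by move: zH; rewrite !inE z_bag => /andP[->].
  apply: reach_nil; first exact: setU11.
  rewrite (le_trans _ le_N)// addr_ge0 ?w_ge0 //; exact: reach_ge0 rsy.
have [v v_bag rvy] := IH s_bag; exists v => //.
apply: (reach_rcons rvy Eyz) le_N.
by move: zH; rewrite !inE (negbTE z_bag) orbF => ->; rewrite orbT.
Qed.

Variable r : K.
Hypothesis r_ge0 : 0 <= r.

Definition ball v := [set u | `[< reach [set: V] v u r >]]%SET.

Lemma ball_center v : v \in ball v.
Proof. by rewrite inE; apply/asboolP; apply: reach_nil; rewrite ?inE. Qed.

Lemma ball_radius v u : u \in ball v -> reach (ball v) v u r.
Proof.
rewrite inE => /asboolP rvu; have uT : u \in [set: V] by rewrite inE.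
apply: (reach_between (t := u) (M := 0) _ rvu (reach_nil _ _ uT (lexx 0))).
move=> z N N' rvz rzu; rewrite addr0 inE => le_r; apply/asboolP.
apply: reach_le rvz; apply: le_trans le_r.
by rewrite lerDl; exact: reach_ge0 rzu.
Qed.

Lemma ball_diam v u u' : u \in ball v -> u' \in ball v ->
  reach (ball v) u u' (2 * r).
Proof.
move=> /ball_radius /(reach_sym Esym w_sym) ru /ball_radius ru'.
by rewrite mulr_natl mulr2n; exact: reach_trans ru'.
Qed.

(** Choose [u] with highest top. A walk in the ball leaving [below (top T u)] would step into
    [bag (top T u)], at a vertex whose top is an ancestor, hence equal by minimality. *)
Lemma ball_top v : exists2 u, u \in ball v & ball v \subset below (top T u).
Proof.
have := ball_center v.
pose u := [arg min_(u < v | u \in ball v) depth (top T u)].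
exists u; rewrite {}/u; case: arg_minnP => // u uv min_u.
apply/subsetP => y /(ball_diam uv).
elim=> [_ _ _|y' z M N ruy yu Eyz zv _]; first exact: top_below.
move: (edge_region Eyz yu); rewrite /region in_setU => /orP[//|/bag_anc].
move=> /(anc_depth (parent_root T) (@depth_parent _ _ _ T)) [eq_zu|].
  by rewrite -eq_zu top_below.
by rewrite ltnNge min_u.
Qed.

End Separation.

(** * Clusters and the recursive cover *)

Section Cover.
Variables (K : realFieldType) (V : finType) (E : rel V) (w : V -> V -> K).
Hypothesis Esym : symmetric E.
Hypothesis w_ge0 : forall u v, E u v -> 0 <= w u v.
Hypothesis w_sym : forall u v, E u v -> w u v = w v u.
Variables (k : nat) (T : rooted_decomposition E k).
Variable r : K.
Hypothesis r_ge0 : 0 <= r.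
Implicit Types (u v x y z : V) (a c p q : node T) (D H C : {set V}).
Implicit Types (S : {set node T}) (cov : {set {set V}}).

Notation "p <: a" := (anc (@parent _ _ _ T) p a) (at level 70).
Notation reach := (reach E w).
Notation ball := (ball E w r).

(** The radius is half the budget [8 * r] of cluster walks: of two pieces within the budget one
    fits, and two pieces longer than it exceed the budget. *)
Definition near H p :=
  [set u | `[< exists2 s, s \in bag p & reach (H :&: region p) s u (4 * r) >]]%SET.

Definition hit H p a := bag a :&: near H p != set0.

Lemma near_sub H H' p : H \subset H' -> near H p \subset near H' p.
Proof.
move=> HH'; apply/subsetP => u; rewrite !inE => /asboolP[s sp rsu].
by apply/asboolP; exists s => //; apply: reach_sub rsu; exact: setSI.
Qed.

(** A walk from [bag p] to [bag a] meets the separator [bag c] earlier. *)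
Lemma hit_up H p c a : p <: c -> p != c -> c <: a -> hit H p a -> hit H p c.
Proof.
move=> pc p_c ca /set0Pn[z]; rewrite !inE => /andP[za /asboolP[s sp rsz]].
have sc : s \notin below c.
  rewrite inE; apply/negP => /anc_trans /(_ (bag_anc sp)) cp; case/eqP: p_c.
  exact: anc_antisym (parent_root T) (@depth_parent _ _ _ T) _ _ pc cp.
have [z' [M [N [z'c rsz' rz'z le_MN]]]] :=
  reach_separator Esym rsz sc (bag_region ca za).
apply/set0Pn; exists z'; rewrite !inE; move: z'c; rewrite inE => /andP[-> _].
apply/asboolP; exists s => //; apply: reach_le rsz'; apply: le_trans le_MN.
by rewrite lerDl; exact: reach_ge0 rz'z.
Qed.

(* [H] is the part of the graph still in play and [S] the part of the tree to be
   treated; the fourth clause says that clusters leave [S] only by a short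
   distance, so they stay clear of the next segment once its core is removed. *)
Definition partial_cover ell H S p0 cov :=
  [/\ forall C, C \in cov -> C \subset H,
      forall C, C \in cov -> forall u v, u \in C -> v \in C ->
        reach C u v (16 * r),
      forall v u, ball v \subset H -> u \in ball v -> top T u \in S ->
        ball v \subset below (top T u) ->
        exists2 C, C \in cov & ball v \subset C,
      forall q C y, C \in cov -> p0 <: q -> q \notin S -> y \in C ->
        y \in below q -> y \in near H q &
      forall u, (#|[set C in cov | u \in C]%SET| <= ell * ell.+2)%nat].

Section Segments.
Variables (ell : nat) (H : {set V}) (S : {set node T}) (p0 : node T).
Hypothesis S_under : forall a, a \in S -> p0 <: a.
Hypothesis S_convex : forall a c, a \in S -> p0 <: c -> c <: a -> c \in S.
Hypothesis S_card : forall a, a \in S -> (#|bag a :&: H| <= ell.+1)%nat.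
Variable core : node T -> node T.
Hypothesis coreP : forall a, p0 <: a ->
    [/\ p0 <: core a, core a <: a,
        forall c, core a <: c -> c <: a -> core c = core a,
        core a != a -> hit H (core a) a &
        core a = a -> forall p, p0 <: p -> core p = p -> p <: a -> p != a ->
          ~~ hit H p a].

Definition cores := [set p in S | core p == p]%SET.
Definition segment p := [set a in S | core a == p]%SET.
Definition remainder p := (H :&: below p) :\: near H p.

(** Smaller than a ball: the walk through [u] must end, within the budget, at some [t] with top in
    [S], which keeps excursions out of [S] short. *)
Definition cluster x :=
  [set u | `[< exists p t L M, [/\ p \in cores /\ x \in bag p, top T t \in S,
     reach (x |: (H :&: below p)) x u L, reach (x |: (H :&: below p)) u t M &
     L + M <= 8 * r] >]]%SET.

Lemma core_domain_sub x p : x \in H -> x \in bag p ->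
  x |: (H :&: below p) \subset H :&: region p.
Proof.
move=> xH xp; rewrite subUset sub1set !inE xH xp orbT /=.
by apply: setIS; exact: subsetUl.
Qed.

Lemma cluster_sub x : x \in H -> cluster x \subset H.
Proof.
move=> xH; apply/subsetP => u; rewrite inE => /asboolP[p [t [L [M [[_ xp] _ rxu _ _]]]]].
by have := subsetP (core_domain_sub xH xp) _ (reach_end rxu); rewrite inE => /andP[].
Qed.

Lemma cluster_center x u : u \in cluster x -> reach (cluster x) x u (8 * r).
Proof.
rewrite inE => /asboolP[p [t [L [M [[pc xp] tS rxu rut le_LM]]]]].
apply: (@reach_le _ _ _ _ _ _ _ L).
  by apply: le_trans le_LM; rewrite lerDl; exact: reach_ge0 rut.
apply: (reach_between _ rxu rut) => z N N' rxz rzt le_N.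
rewrite inE; apply/asboolP; exists p, t, N, N'; split=> //.
exact: le_trans le_LM.
Qed.

Lemma cluster_diam x u v : u \in cluster x -> v \in cluster x ->
  reach (cluster x) u v (16 * r).
Proof.
move=> /cluster_center /(reach_sym Esym w_sym) rux /cluster_center rxv.
have -> : 16 * r = 8 * r + 8 * r by lra.
exact: reach_trans rux rxv.
Qed.

(** By convexity of [S], both [x] and [t] are outside [below q], so the walk meets [bag q] before
    and after [y]. The two pieces joining [y] to [bag q] total at most [8 * r]; one is at most
    [4 * r]. *)
Lemma cluster_near x q y : x \in H -> p0 <: q -> q \notin S ->
  y \in cluster x -> y \in below q -> y \in near H q.
Proof.
move=> xH p0q qS; rewrite inE => /asboolP[p [t [L [M [[pc xp] tS rxy ryt le_LM]]]]] yq.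
have [pS _] : p \in S /\ core p == p by move: pc; rewrite inE => /andP.
have xq : x \notin below q.
  rewrite inE; apply: contra qS => /anc_trans /(_ (bag_anc xp)).
  exact: S_convex.
have tq : t \notin below q.
  by rewrite inE; apply: contra qS; exact: S_convex.
have yq' : y \in region q by rewrite inE yq.
have DH : x |: (H :&: below p) \subset H.
  by apply: subset_trans (core_domain_sub xH xp) (subsetIl _ _).
have [z1 [M1 [N1 [z1q rxz1 rz1y le1]]]] := reach_separator Esym rxy xq yq'.
have [z2 [M2 [N2 [z2q rtz2 rz2y le2]]]] :=
  reach_separator Esym (reach_sym Esym w_sym ryt) tq yq'.
have M1_ge0 := reach_ge0 w_ge0 rxz1; have M2_ge0 := reach_ge0 w_ge0 rtz2.
rewrite inE; apply/asboolP; have [le_N1|lt_N1] := leP N1 (4 * r).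
  exists z1; first by move: z1q; rewrite inE => /andP[].
  by apply: reach_le le_N1 (reach_sub _ rz1y); exact: setSI.
exists z2; first by move: z2q; rewrite inE => /andP[].
by apply: (@reach_le _ _ _ _ _ _ _ N2); [lra|apply: reach_sub rz2y; exact: setSI].
Qed.

Definition seen_cores u :=
  [set p in cores | (u \in below p) &&
     `[< exists2 s, s \in bag p & reach (H :&: region p) s u (8 * r) >]]%SET.

(** The walk from [bag p1] to [u] crosses [bag p2], then [bag p3]. No core hits a later one, so each
    leg exceeds [4 * r], against the budget [8 * r]. *)
Lemma seen_cores_chain u p1 p2 p3 : p1 \in seen_cores u ->
  p2 \in seen_cores u -> p3 \in seen_cores u ->
  p1 <: p2 -> p1 != p2 -> p2 <: p3 -> p2 != p3 -> False.
Proof.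
have antisym := anc_antisym (parent_root T) (@depth_parent _ _ _ T).
rewrite !inE => /andP[/andP[S1 /eqP c1] /andP[u1 /asboolP[s s1 rsu]]].
move=> /andP[/andP[S2 /eqP c2] /andP[u2 _]] /andP[/andP[S3 /eqP c3] /andP[u3 _]].
move=> p12 n12 p23 n23.
have [_ _ _ _ /(_ c2) no_hit2] := coreP (S_under S2).
have [_ _ _ _ /(_ c3) no_hit3] := coreP (S_under S3).
have notin p q z : p <: q -> p != q -> z \in bag p -> z \notin below q.
  move=> pq n_pq zp; rewrite inE; apply/negP => /anc_trans /(_ (bag_anc zp)) qp.
  by rewrite (antisym _ _ pq qp) eqxx in n_pq.
have far p q z s' D L : p \in S -> core p = p -> ~~ hit H p q ->
    z \in bag q -> s' \in bag p -> D \subset H :&: region p ->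
    reach D s' z L -> 4 * r < L.
  move=> pS cp no_hit zq s'p DH rs'z; rewrite ltNge; apply: contra no_hit => le_L.
  apply/set0Pn; exists z; rewrite !inE zq; apply/asboolP; exists s' => //.
  exact: reach_le le_L (reach_sub DH rs'z).
have u2' : u \in region p2 by rewrite !inE u2.
have u3' : u \in region p3 by rewrite !inE u3.
have [z2 [M2 [N2 [+ rsz2 rz2u le2]]]] :=
  reach_separator Esym rsu (notin _ _ _ p12 n12 s1) u2'.
rewrite inE => /andP[z2p _].
have [z3 [M3 [N3 [+ rz2z3 rz3u le3]]]] :=
  reach_separator Esym rz2u (notin _ _ _ p23 n23 z2p) u3'.
rewrite inE => /andP[z3p _].
have lt2 := far _ _ _ _ _ _ S1 c1 (no_hit2 _ (S_under S1) c1 p12 n12) z2p s1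
  (subxx _) rsz2.
have lt3 := far _ _ _ _ _ _ S2 c2 (no_hit3 _ (S_under S2) c2 p23 n23) z3p z2p
  (setSI _ (subsetIl _ _)) rz2z3.
by have := reach_ge0 w_ge0 rz3u; lra.
Qed.

Lemma card_seen_cores u : (#|seen_cores u| <= 2)%nat.
Proof.
rewrite leqNgt; apply/negP => /card_gt2P[p [q [s [[pu qu su] [pq qs sp]]]]].
have comparable c d : c \in seen_cores u -> d \in seen_cores u ->
    c <: d \/ d <: c.
  by rewrite !inE => /andP[_ /andP[cu _]] /andP[_ /andP[du _]]; exact: anc_total cu du.
have qp : q != p by rewrite eq_sym.
have sq : s != q by rewrite eq_sym.
have ps : p != s by rewrite eq_sym.
have [p_q|q_p] := comparable p q pu qu; have [q_s|s_q] := comparable q s qu su;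
  have [p_s|s_p] := comparable p s pu su.
- exact: (seen_cores_chain pu qu su).
- exact: (seen_cores_chain pu qu su).
- exact: (seen_cores_chain pu su qu).
- exact: (seen_cores_chain su pu qu).
- exact: (seen_cores_chain qu pu su).
- exact: (seen_cores_chain qu su pu).
- exact: (seen_cores_chain su qu pu).
- exact: (seen_cores_chain su qu pu).
Qed.

(** Unless [x = u], the centre [x] lies in the bag of one of at most two seen cores. *)
Lemma card_clusters u :
  (#|[set x in H | u \in cluster x]%SET| <= 1 + 2 * ell.+1)%nat.
Proof.
have sub : [set x in H | u \in cluster x]%SET \subset
    u |: \bigcup_(p in seen_cores u) (bag p :&: H).
  apply/subsetP => x; rewrite inE => /andP[xH]; rewrite inE.
  move=> /asboolP[p [t [L [M [[pc xp] _ rxu rut le_LM]]]]]; rewrite !inE.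
  have [//|x_u] := eqVneq x u; apply/bigcupP; exists p; last by rewrite inE xp.
  rewrite inE pc /=; apply/andP; split.
    by have := reach_end rxu; rewrite !inE eq_sym (negbTE x_u) => /andP[].
  apply/asboolP; exists x => //; apply: reach_sub (core_domain_sub xH xp) _.
  apply: reach_le rxu; apply: le_trans le_LM.
  by rewrite lerDl; exact: reach_ge0 rut.
apply: leq_trans (subset_leq_card sub) _.
apply: leq_trans (leq_card_setU _ _) _; rewrite cards1 leq_add2l.
apply: leq_trans (unstable.card_big_setU _ _ _) _.
apply: (@leq_trans (\sum_(p in seen_cores u) ell.+1)%nat).
  by apply: leq_sum => p; rewrite !inE => /andP[/andP[pS _] _]; exact: S_card.
by rewrite sum_nat_const leq_mul2r card_seen_cores orbT.
Qed.

Lemma cluster_padded v u p y : ball v \subset H -> u \in ball v ->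
  top T u \in S -> p \in cores -> ball v \subset below p ->
  y \in ball v -> y \in near H p ->
  exists2 x, x \in H & ball v \subset cluster x.
Proof.
move=> vH uv uS pc vp yv; rewrite inE => /asboolP[s sp rsy].
have [x] := reach_exit w_ge0 rsy sp; rewrite inE => /andP[xp xH] rxy.
have sub : ball v \subset x |: (H :&: below p).
  by apply: subset_trans (subsetUr _ _); rewrite subsetI vH.
exists x => //; apply/subsetP => b bv; rewrite inE; apply/asboolP.
(* At most [4 * r] from [x] to [y], then [2 * r] to [b] and [2 * r] to [u] inside the ball: hence
   the budget [8 * r]. *)
exists p, u, (4 * r + 2 * r), (2 * r); split=> //.
- by apply: reach_trans rxy _; apply: reach_sub sub _; exact: ball_diam.
- by apply: reach_sub sub _; exact: ball_diam.
- lra.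
Qed.

(** A surviving [z] shows [a] is not [p], as [bag p :&: H] is all near. So [p] hits [a], and the
    vertex hit is deleted. *)
Lemma card_remainder p a : a \in segment p ->
  (#|bag a :&: remainder p| <= ell)%nat.
Proof.
rewrite inE => /andP[aS /eqP ca].
have [->|[z]] := set_0Vmem (bag a :&: remainder p); first by rewrite cards0.
rewrite in_setI in_setD in_setI => /and3P[za z_far /andP[zH _]].
have [_ _ _ hit_a _] := coreP (S_under aS).
have /set0Pn[y] : hit H p a.
  rewrite -ca; apply: hit_a; apply: contra z_far => /eqP ca'.
  rewrite inE; apply/asboolP; exists z; first by rewrite -ca ca'.
  apply: reach_nil; last by rewrite mulr_ge0.
  by rewrite !inE zH -ca ca' za orbT.
rewrite inE => /andP[ya yn].
have yH : y \in H.
  by move: yn; rewrite inE => /asboolP[s _ /reach_end]; rewrite inE => /andP[].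
rewrite -ltnS; apply: leq_trans (S_card aS); apply: proper_card.
apply/properP; split.
  by apply: setIS; apply: subset_trans (subsetDl _ _) (subsetIl _ _).
by exists y; rewrite in_setI ya ?yH // in_setD yn.
Qed.

End Segments.
Lemma exists_partial_cover ell H S p0 :
    (forall a, a \in S -> p0 <: a) ->
    (forall a c, a \in S -> p0 <: c -> c <: a -> c \in S) ->
    (forall a, a \in S -> #|bag a :&: H| <= ell)%nat ->
  exists cov, partial_cover ell H S p0 cov.
Proof.
elim: ell H S p0 => [|ell IH] H S p0 S_under S_convex S_card.
  (* No ball needs covering: [u] would lie in its own top bag, which misses [H]. *)
  exists set0; split=> [C|C|v u vH uv uS _|q C y|u].
  - by rewrite inE.
  - by rewrite inE.
  - have := S_card _ uS; rewrite leqn0 cards_eq0 => /eqP/setP/(_ u).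
    by rewrite !inE bag_top (subsetP vH).
  - by rewrite inE.
  - by rewrite leqn0 cards_eq0; apply/eqP/setP => C; rewrite !inE.
have [core coreP] := exists_core p0 (@hit_up H).
(* The premise sits under the existential so that choice applies to every node. *)
have exists_rest p : exists cov, p \in cores S core ->
    partial_cover ell (remainder H p) (segment S core p) p cov.
  have [pc|_] := boolP (p \in cores S core); last by exists set0.
  have [pS core_p] : p \in S /\ core p = p by move: pc; rewrite inE => /andP[? /eqP].
  have [|||cov cov_p] := IH (remainder H p) (segment S core p) p; last by exists cov.
  - move=> a; rewrite inE => /andP[aS /eqP <-].
    by have [] := coreP _ (S_under _ aS).
  - move=> a c; rewrite !inE => /andP[aS /eqP core_a] pc' ca.
    have [_ _ core_eq _ _] := coreP _ (S_under _ aS).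
    rewrite core_eq ?core_a // eqxx andbT; apply: S_convex ca => //.
    exact: anc_trans (S_under _ pS) pc'.
  - by move=> a; exact: (card_remainder S_under S_card coreP).
have [rest restP] := choice exists_rest => {exists_rest}.
have core_inv p : p \in cores S core -> p \in S /\ core p = p.
  by rewrite inE => /andP[? /eqP].
(* Two recursive families never share a vertex: leaving the segment of [p] into
   that of [q], a cluster stays near [q], which is removed from the latter. *)
have rest_lt p q C C' u : p \in cores S core -> q \in cores S core ->
    C \in rest p -> C' \in rest q -> u \in C -> u \in C' -> p <: q -> p = q.
  move=> pc qc Cp Cq uC uC' pq; apply/eqP/negP => /negP p_q.
  have [sub_p _ _ near_p _] := restP _ pc; have [sub_q _ _ _ _] := restP _ qc.
  have := subsetP (sub_q _ Cq) _ uC'.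
  rewrite in_setD in_setI => /andP[/negP u_far /andP[_ uq]]; apply: u_far.
  have qS : q \notin segment S core p.
    by rewrite inE (core_inv _ qc).2 eq_sym (negbTE p_q) andbF.
  apply: (subsetP (near_sub _ _) _ (near_p _ _ _ Cp pq qS uC uq)).
  exact: subset_trans (subsetDl _ _) (subsetIl _ _).
have rest_eq p q C C' u : p \in cores S core -> q \in cores S core ->
    C \in rest p -> C' \in rest q -> u \in C -> u \in C' -> p = q.
  move=> pc qc Cp Cq uC uC'.
  have below_of s D : s \in cores S core -> D \in rest s -> u \in D ->
      s <: top T u.
    move=> sc Ds uD; have [sub_s _ _ _ _] := restP _ sc.
    by have := subsetP (sub_s _ Ds) _ uD; rewrite !inE => /and3P[].
  have [pq|qp] := anc_total (below_of _ _ pc Cp uC) (below_of _ _ qc Cq uC').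
    exact: (rest_lt _ _ _ _ _ pc qc Cp Cq uC uC' pq).
  by apply/esym; exact: (rest_lt _ _ _ _ _ qc pc Cq Cp uC' uC qp).
pose clusters := [set cluster H S core x | x in H]%SET.
exists (clusters :|: \bigcup_(p in cores S core) rest p); split.
- move=> C; rewrite inE => /orP[/imsetP[x xH ->]|/bigcupP[p pc Cp]].
    exact: cluster_sub.
  have [sub_p _ _ _ _] := restP _ pc; apply: subset_trans (sub_p _ Cp) _.
  exact: subset_trans (subsetDl _ _) (subsetIl _ _).
- move=> C; rewrite inE => /orP[/imsetP[x xH ->] u v|/bigcupP[p pc Cp]].
    exact: cluster_diam.
  by have [_ diam_p _ _ _] := restP _ pc; exact: diam_p.
- move=> v u vH uv uS v_below.
  have [p0p p_u core_eq _ _] := coreP _ (S_under _ uS).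
  set p := core (top T u) in p0p p_u core_eq.
  have pc : p \in cores S core.
    by rewrite inE (S_convex _ _ uS p0p p_u) core_eq ?eqxx ?anc_refl.
  have vp : ball v \subset below p := subset_trans v_below (below_sub p_u).
  have [v_far|[y]] := set_0Vmem (ball v :&: near H p).
    have [_ _ pad_p _ _] := restP _ pc.
    have vH' : ball v \subset remainder H p.
      by rewrite subsetD subsetI vH vp -setI_eq0 v_far eqxx.
    have uS' : top T u \in segment S core p by rewrite inE uS eqxx.
    have [C Cp vC] := pad_p v u vH' uv uS' v_below.
    by exists C => //; rewrite inE; apply/orP; right; apply/bigcupP; exists p.
  rewrite inE => /andP[yv yp].
  have [x xH vx] := cluster_padded vH uv uS pc vp yv yp.
  by exists (cluster H S core x) => //; rewrite inE imset_f.
- move=> q C y + p0q qS; rewrite inE => /orP[/imsetP[x xH ->]|/bigcupP[p pc Cp]].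
    exact: (cluster_near S_convex).
  move=> yC yq; have [sub_p _ _ near_p _] := restP _ pc.
  have [pS core_p] := core_inv _ pc.
  have yp : p <: top T y.
    by have := subsetP (sub_p _ Cp) _ yC; rewrite in_setD in_setI !inE => /and3P[].
  have yq' : q <: top T y by move: yq; rewrite inE.
  (* If [q] were above [p], convexity would put it in [S]. *)
  have [pq|qp] := anc_total yp yq'; last first.
    by rewrite (S_convex _ _ pS p0q qp) in qS.
  have qS' : q \notin segment S core p by rewrite inE (negbTE qS).
  apply: (subsetP (near_sub _ _) _ (near_p _ _ _ Cp pq qS' yC yq)).
  exact: subset_trans (subsetDl _ _) (subsetIl _ _).
move=> u.
(* The bound [ell * ell.+2] is the sum of [1 + 2 * l] for [l] from 1 to [ell]. *)
have -> : (ell.+1 * ell.+3 = (1 + 2 * ell.+1) + ell * ell.+2)%nat by lia.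
pose near_u := [set cluster H S core x | x in [set x in H | u \in cluster H S core x]]%SET.
pose rest_u := [set C in \bigcup_(p in cores S core) rest p | u \in C]%SET.
have sub : [set C in clusters :|: \bigcup_(p in cores S core) rest p | u \in C]%SET
    \subset near_u :|: rest_u.
  apply/subsetP => C; rewrite inE => /andP[+ uC]; rewrite !in_setU.
  move=> /orP[/imsetP[x xH eqC]|Crest]; apply/orP; [left|right].
    by rewrite eqC imset_f // inE xH -eqC.
  by rewrite inE Crest.
apply: leq_trans (subset_leq_card sub) _.
apply: leq_trans (leq_card_setU _ _) _; apply: leq_add.
  apply: leq_trans (leq_imset_card _ _) _.
  exact: (card_clusters S_under S_card coreP).
(* By [rest_eq], one recursive cluster at [u] fixes the core, so a single family is counted. *)
have [->|[C0]] := set_0Vmem rest_u; first by rewrite cards0.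
rewrite inE => /andP[/bigcupP[p pc Cp] uC0]; have [_ _ _ _ count_p] := restP _ pc.
apply: leq_trans (count_p u); apply: subset_leq_card; apply/subsetP => C.
rewrite !inE => /andP[/bigcupP[q qc Cq] uC].
by rewrite uC (rest_eq _ _ _ _ _ pc qc Cp Cq uC0 uC) Cq.
Qed.

End Cover.

Theorem theorem1p2 :
  exists (beta c K : R), [/\ 1 <= beta, 0 < c, 0 < K &
    forall (V : finType) (E : rel V) (w : V -> V -> R),
      weighted_graph E w -> connected_graph E ->
      forall tw : nat, is_treewidth E tw ->
      forall Delta : R, 0 < Delta ->
      exists cov : {set {set V}},
        strong_sparse_cover E w beta (K * (tw.+1)%:R `^ c) Delta cov].
Proof.
(* With [r = Delta / 16] the diameter [16 * r] is [Delta]; 32 leaves the slack required by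
   [dist_reach]; and [tw.+1 * tw.+3] is at most three times the square of [tw.+1]. *)
exists 32, 2, 3; split; rewrite ?ler1n ?ltr0n //.
move=> V E w [Esym _ w_ge0 w_sym] _ tw [/tree_decomposition_rooted[T] _] Delta D_gt0.
have r_ge0 : 0 <= Delta / 16 by lra.
have [|||cov [_ diam pad _ count]] := exists_partial_cover Esym w_ge0 w_sym r_ge0
  (T := T) (ell := tw.+1) (H := [set: V]) (S := [set: node T]) (p0 := node_root T).
- by move=> a _; exact: (anc_root (@depth_parent _ _ _ T)).
- by move=> *; rewrite inE.
- by move=> a _; rewrite setIT card_bag.
exists cov; split=> [C Ccov u v uC vC|v|v].
- have -> : Delta = 16 * (Delta / 16) by lra.
  exact: reach_dist (diam C Ccov u v uC vC).
- have [u uv v_below] := ball_top Esym w_ge0 w_sym T r_ge0 v.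
  have [C Ccov vC] := pad v u (subsetT _) uv (in_setT _) v_below.
  exists C => // y le_vy; apply: (subsetP vC); rewrite inE; apply/asboolP.
  by apply: dist_reach le_vy; lra.
rewrite RmultE powR_mulrn ?ler0n // expr2 -!natrM ler_nat.
apply: leq_trans (count v) _; lia.
Qed.
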